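(* Let $f,g:\mathbb{R}^n\to\bar{\mathbb{R}}$ be proper convex functions, let $x\in\mathbb{R}^n$, and let $T_a = T_a(\operatorname{dom}(f),\operatorname{dom}(g))$ be the affine joint supporting subspace of the effective domains. Then $$\partial(f+g)(x) = \partial (f + \iota_{T_a})(x) + \partial (g + \iota_{T_a})(x),$$ where the sum on the right is the Minkowski sum of sets.
   Context: $\bar{\mathbb{R}}=\mathbb{R}\cup\{-\infty,\infty\}$. For convex $f:\mathbb{R}^n\to\bar{\mathbb{R}}$, $\operatorname{dom}(f)=\{x: f(x)\neq\infty\}$; $f$ is proper if it is nowhere $-\infty$ and $\operatorname{dom}(f)\ne\emptyset$. The subdifferential is $\partial f(x)=\{v\in\mathbb{R}^n \mid \forall y\in\mathbb{R}^n,\ f(x)+\langle v,y-x\rangle\le f(y)\}$ for $x\in\operatorname{dom}(f)$, and $\partial f(x)=\emptyset$ when $x\notin\operatorname{dom}(f)$. For a set $S$, $\iota_S$ is the indicator function, $0$ on $S$ and $\infty$ off $S$. $A\pm B=\{a\pm b\mid a\in A,b\in B\}$ (empty if $A$ or $B$ is empty). Faces: for $C\subseteq\mathbb{R}^n$ convex, a subset $F\subseteq C$ is a face of $C$ if for all $y,z\in C$, whenever the open segment $]y,z[ = [y,z]\setminus\{y,z\}$ meets $F$, both $y,z\in F$. For $S\subseteq C$, $F_C(S)$ denotes the smallest face of $C$ containing $S$; $F_C(x)=F_C(\{x\})$. Joint supporting subspace: for convex $C,D\subseteq\mathbb{R}^n$ with $C\cap D\neq\emptyset$, $T(C,D):=\operatorname{Span}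 F_{C-D}(0)$ (linear span) and $T_a(C,D):=T(C,D)+(C\cap D)$. If $C\cap D=\emptyset$, then $T_a(C,D)=\emptyset$. *)

(* Defs.v *)
From HB Require Import structures.
From mathcomp Require Import all_boot all_order all_algebra.
From mathcomp Require Import all_classical all_reals.
From mathcomp Require Import convex.

Set Implicit Arguments.
Unset Strict Implicit.
Unset Printing Implicit Defensive.

Import Order.TTheory GRing.Theory Num.Theory.

Local Open Scope classical_set_scope.
Local Open Scope ring_scope.

Section convex_geometry.
Context {R : realType} {n : nat}.
Implicit Types (x y z u v : 'rV[R]_n) (A B C D F S : set 'rV[R]_n).

Definition dotv u v : R := \sum_(i < n) u ord0 i * v ord0 i.

Definition minkowski_sum A B : set 'rV[R]_n := [set a + b | a in A & b in B].
Definition minkowski_diff A B : set 'rV[R]_n := [set a - b | a in A & b in B].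

Definition segment y z : set 'rV[R]_n :=
  [set (1 - t) *: y + t *: z | t in `[0, 1]].

(* Empty when y = z. *)
Definition open_segment y z : set 'rV[R]_n := segment y z `\` [set y; z].

(* Convexity of F is deliberately not required. *)
Definition is_face C F : Prop :=
  F `<=` C /\
  forall y z, C y -> C z -> open_segment y z `&` F !=set0 -> F y /\ F z.

(* Intersection of all the faces of C containing S; it is the smallest one
   when S `<=` C, see face_hull_is_face. *)
Definition face_hull C S : set 'rV[R]_n := smallest (is_face C) S.

Lemma face_hull_is_face C S : S `<=` C -> is_face C (face_hull C S).
Proof.
move=> SC; have CC : is_face C C by split.
split=> [|y z Cy Cz [w [yzw Fw]]]; first exact: smallest_sub.
have FyFz F : is_face C F /\ S `<=` F -> F y /\ F z.
  by move=> SF; apply: SF.1.2 => //; exists w; split=> //; exact: Fw.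
by split=> F SF; have [] := FyFz F SF.
Qed.

(* Smallest linear subspace containing S. *)
Definition lin_span S : set 'rV[R]_n :=
  smallest (fun V : set 'rV[R]_n => submod_closed [in V]) S.

Lemma lin_span_submod S : submod_closed [in lin_span S].
Proof.
split=> [|a u v]; rewrite !inE.
  by move=> V [[V0 _] _]; move: V0; rewrite inE.
move=> Su Sv V SV; have [[_ VL] _] := SV.
by have := VL a u v; rewrite !inE; apply; [exact: Su|exact: Sv].
Qed.

(* Meaningful only when C and D meet, i.e. when 0 belongs to C - D. *)
Definition joint_supp C D : set 'rV[R]_n :=
  lin_span (face_hull (minkowski_diff C D) [set 0]).

(* Empty when C and D are disjoint. *)
Definition aff_joint_supp C D : set 'rV[R]_n :=
  minkowski_sum (joint_supp C D) (C `&` D).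

End convex_geometry.

Section convex_functions.
Context {R : realType} {n : nat}.
Implicit Types (f : 'rV[R]_n -> \bar R) (x y v : 'rV[R]_n).

Definition edom f : set 'rV[R]_n := [set x | f x != +oo%E].

Definition epigraph f : set ('rV[R]_n * R^o) := [set p | (f p.1 <= p.2%:E)%E].

(* Stated with the epigraph so that no convention for +oo - oo is involved. *)
Definition convex_efun f : Prop := convex_set (epigraph f).

Definition proper_efun f : Prop := (forall x, f x != -oo%E) /\ edom f !=set0.

Definition subdiff f x : set 'rV[R]_n :=
  [set v | edom f x /\ forall y, (f x + (dotv v (y - x))%:E <= f y)%E].

Definition iota_set (S : set 'rV[R]_n) x : \bar R :=
  if x \in S then 0%E else +oo%E.

End convex_functions.

(* Main.v *)
Require Import Defs.
From mathcomp Require Import all_boot all_order all_algebra.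
From mathcomp Require Import all_classical all_reals.
From mathcomp Require Import interval_inference convex.
From mathcomp Require Import ring lra.

Set Implicit Arguments.
Unset Strict Implicit.
Unset Printing Implicit Defensive.

Import Order.TTheory GRing.Theory Num.Theory.

Local Open Scope classical_set_scope.
Local Open Scope ring_scope.

(** Adding to [f] and [g] the indicator of [Ta] does not change [f + g],
because [Ta] contains [edom f `&` edom g].  What it changes is the relative
position of the domains: after the restriction, the usual constraint
qualification of the subdifferential sum rule holds inside [Ta], and the
theorem is that sum rule applied to the two restricted functions.

The qualification.  Write [C], [D] for the domains, [K := C - D], and suppose
that [C] and [D] meet, so that [0] is in [K].  The span of the smallest face
of [K] through [0] is the set of directions [t] along which [K] contains a
segment having [0] in its interior ([lin_span_face0]): those directions form
a subspace, the points of [K] with such a direction form a face, and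
conversely each such segment lies in every face through [0].  If
[e *: t = c - d] and [- (e *: t) = c' - d'] are the ends of such a segment,
then [c + c' = d + d'], and the half-sum [p] lies in [C `&` D].  The
differences [c - p] and [c' - p] are opposite elements of [K], hence lie in
the subspace, so that [c], and likewise [d], is in [Ta]
([joint_supp_restricted_diff]).  Thus the difference of the restricted domains
generates as a cone the whole direction space of [Ta].

The sum rule ([subdiffD]).  For [v] in the subdifferential of [f + g] at [x],
consider the perturbation [f c + g d - dotv v d], as a function of [c - d],
minus its infimum over [c = d].  The cone generated by its epigraph lies above
[0] over the origin, and its projection on the space of perturbations is
symmetric by the qualification, hence a subspace.  A Hahn-Banach extension
([dominated_functional]) gives a linear form [w] below this cone; taking
[d = x], then [c = x], shows that [w] and [v - w] are subgradients of [f] and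
[g]. *)

(** * Convex sets and the dot product *)

Lemma convex_setP (R : realType) (V : lmodType R) (K : set V) :
  convex_set K <->
  forall x y s t, 0 <= s -> 0 <= t -> s + t = 1 -> K x -> K y ->
    K (s *: x + t *: y).
Proof.
split=> [cK x y s t s0 t0 st1 Kx Ky|cK x y l]; last first.
  rewrite !inE => Kx Ky; apply: cK => //.
  - by rewrite subr_ge0.
  - by rewrite addrC subrK.
have s1 : s <= 1 by rewrite -st1 lerDl.
have -> : t = 1 - s by rewrite -st1 addrC addKr.
by have := cK x y (Itv01 s0 s1); rewrite !inE; exact.
Qed.

Section dot_product.
Context {R : realType} {n : nat}.
Implicit Types (u v w : 'rV[R]_n) (a : R).

Lemma dotvDr u v w : dotv u (v + w) = dotv u v + dotv u w.
Proof.
by rewrite /dotv -big_split; apply: eq_bigr => i _; rewrite mxE mulrDr.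
Qed.

Lemma dotvDl u v w : dotv (u + v) w = dotv u w + dotv v w.
Proof.
by rewrite /dotv -big_split; apply: eq_bigr => i _; rewrite mxE mulrDl.
Qed.

Lemma dotvZr a u v : dotv u (a *: v) = a * dotv u v.
Proof.
by rewrite /dotv big_distrr; apply: eq_bigr => i _; rewrite mxE mulrCA.
Qed.

Lemma dotvZl a u v : dotv (a *: u) v = a * dotv u v.
Proof.
by rewrite /dotv big_distrr; apply: eq_bigr => i _; rewrite mxE -mulrA.
Qed.

Lemma dotvNr u v : dotv u (- v) = - dotv u v.
Proof. by rewrite -scaleN1r dotvZr mulN1r. Qed.

Lemma dotvNl u v : dotv (- u) v = - dotv u v.
Proof. by rewrite -scaleN1r dotvZl mulN1r. Qed.

Lemma dotv0 u : dotv u 0 = 0.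
Proof. by rewrite -(scale0r 0) dotvZr mul0r. Qed.

Lemma dotv_delta u i : dotv u (delta_mx ord0 i) = u ord0 i.
Proof.
rewrite /dotv (bigD1 i) //= mxE !eqxx mulr1 big1 ?addr0 // => j /negPf ji.
by rewrite mxE ji andbF mulr0.
Qed.

End dot_product.

(** * Linear forms below a convex cone *)

(** The relation [P] is a convex cone in ['rV_n * R], read as the epigraph of a
sublinear function which may take infinite values.  Instead of finiteness
everywhere, [P_opp] only asks that its domain be symmetric, hence a subspace;
no basis of that subspace has to be chosen. *)
Section hahn_banach.
Context {R : realType} {n : nat}.
Variable P : 'rV[R]_n -> R -> Prop.
Hypothesis P_add : forall t u r s, P t r -> P u s -> P (t + u) (r + s).
Hypothesis P_scale : forall k t r, 0 < k -> P t r -> P (k *: t) (k * r).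
Hypothesis P0_ge0 : forall r, P 0 r -> 0 <= r.
Hypothesis P_opp : forall t r, P t r -> exists s, P (- t) s.

Let vanish_from (k : nat) (t : 'rV[R]_n) :=
  forall i : 'I_n, (k <= i)%N -> t ord0 i = 0.

(** One step of the Hahn-Banach extension: the admissible values [gam] at [e]
are bounded below by [dotv w u - r] for [P (u - e) r] and above by
[r - dotv w u] for [P (u + e) r], and adding two such elements of [P] shows
that the lower bounds are under the upper ones.  By [P_opp] there are lower
bounds if and only if there are upper ones, so that the supremum of the lower
bounds works; when there are none it is a default value on which there is no
constraint. *)
Lemma dominated_functional_step (e : 'rV[R]_n) (V : set 'rV[R]_n) w :
  (forall u v, V u -> V v -> V (u + v)) ->
  (forall u, V u -> V (- u)) ->
  (forall t r, V t -> P t r -> dotv w t <= r) ->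
  exists gam, forall u r, V u ->
    (P (u + e) r -> dotv w u + gam <= r) /\
    (P (u - e) r -> dotv w u - gam <= r).
Proof.
move=> VD VN wP.
pose A := [set a : R | exists u r, [/\ V u, P (u - e) r & a = dotv w u - r]].
have ubA u r : V u -> P (u + e) r -> ubound A (r - dotv w u).
  move=> Vu Pu _ [u' [r' [Vu' Pu' ->]]].
  have := P_add Pu Pu'; rewrite addrACA subrr addr0.
  by move=> /(wP _ _ (VD _ _ Vu Vu')); rewrite dotvDr; lra.
have VoppA u r : V u -> P (u + e) r -> A !=set0.
  move=> Vu /P_opp[s]; rewrite opprD => Ps.
  by exists (dotv w (- u) - s), (- u), s; split => //; exact: VN.
have AoppV a : A a -> exists u r, V u /\ P (u + e) r.
  move=> [u [r [Vu /P_opp[s] Ps _]]]; exists (- u), s; split; first exact: VN.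
  by move: Ps; rewrite opprB addrC.
exists (sup A) => u r Vu; split=> Pu.
  rewrite addrC -lerBrDr; apply: ge_sup (ubA _ _ Vu Pu).
  exact: VoppA Vu Pu.
have Aa : A (dotv w u - r) by exists u, r.
have [u' [r' [Vu' Pu']]] := AoppV _ Aa.
rewrite lerBlDr -lerBlDl; apply: ub_le_sup Aa.
by exists (r' - dotv w u'); exact: ubA.
Qed.

(** The form is extended along the canonical basis, one coordinate at a time. *)
Lemma dominated_functional : exists w, forall t r, P t r -> dotv w t <= r.
Proof.
suff /(_ n)[w wP] k :
    exists w, forall t r, vanish_from k t -> P t r -> dotv w t <= r.
  by exists w => t r; apply: wP => i; rewrite leqNgt ltn_ord.
elim: k => [|k [w wP]].
  exists 0 => t r t0; have -> : t = 0 by apply/rowP => i; rewrite t0 // mxE.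
  by rewrite dotv0; exact: P0_ge0.
have [nk|kn] := leqP n k.
  by exists w => t r _; apply: wP => i; rewrite leqNgt (leq_trans _ nk).
set i0 := Ordinal kn; pose e : 'rV[R]_n := delta_mx ord0 i0.
have [| |gam gamP] := @dominated_functional_step e (vanish_from k) w _ _ wP.
- by move=> u v u0 v0 i ki; rewrite mxE u0 // v0 // addr0.
- by move=> u u0 i ki; rewrite mxE u0 // oppr0.
exists (w + (gam - w ord0 i0) *: e) => t r tk Pt.
pose tau := t ord0 i0; pose u := t - tau *: e.
have uk : vanish_from k u.
  move=> i ki; rewrite !mxE eqxx /=.
  have [->|ii0] := eqVneq i i0; first by rewrite mulr1 subrr.
  rewrite mulr0 subr0 tk // ltn_neqAle ki andbT.
  by apply: contraNneq ii0 => ki'; exact/eqP/val_inj.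
have wt : dotv (w + (gam - w ord0 i0) *: e) t = dotv w u + tau * gam.
  have et : dotv e t = tau.
    rewrite -[RHS]dotv_delta /dotv; apply: eq_bigr => i _; exact: mulrC.
  rewrite dotvDl dotvZl et /u dotvDr dotvNr dotvZr dotv_delta; ring.
rewrite wt; have tE : t = u + tau *: e by rewrite subrK.
have vanishZ c : vanish_from k (c *: u).
  by move=> i ki; rewrite mxE uk // mulr0.
have [tau0|tau0|tau0] := ltgtP tau 0.
- have itau : 0 < - tau^-1 by rewrite oppr_gt0 invr_lt0.
  (* Rescaling reduces the coefficient of [e] in [t] to -1, below to 1. *)
  have := P_scale itau Pt; rewrite tE scalerDr scalerA mulNr mulVf ?lt_eqF//.
  rewrite scaleN1r => /(proj2 (gamP _ _ (vanishZ _))).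
  have := lt_eqF tau0 => /negbT tauN0.
  rewrite dotvZr -(ler_pM2l (_ : 0 < - tau)) ?oppr_gt0//.
  rewrite mulrBr !mulrA mulrNN divff//; lra.
- have itau : 0 < tau^-1 by rewrite invr_gt0.
  have := P_scale itau Pt; rewrite tE scalerDr scalerA mulVf ?gt_eqF//.
  rewrite scale1r => /(proj1 (gamP _ _ (vanishZ _))).
  have := gt_eqF tau0 => /negbT tauN0.
  by rewrite dotvZr -(ler_pM2l tau0) mulrDr !mulrA divff// !mul1r.
- rewrite tau0 mul0r addr0; apply: wP => //.
  by move: Pt; rewrite tE tau0 scale0r addr0.
Qed.

End hahn_banach.

(** * The joint supporting subspace *)

Section line_space.
Context {R : realType} {n : nat}.
Implicit Types (K C D : set 'rV[R]_n) (x y t u : 'rV[R]_n).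

(** For a convex set [K] containing [0], this is the largest linear subspace of
the cone generated by [K]. *)
Definition line_space K : set 'rV[R]_n :=
  [set t | exists2 e : R, 0 < e & K (e *: t) /\ K (- (e *: t))].

Lemma star_shaped K t (a b : R) : convex_set K -> K 0 ->
  0 <= a -> 0 < b -> a <= b -> K (b *: t) -> K (a *: t).
Proof.
move=> /convex_setP cK K0 a0 b0 ab Kt.
have := cK (b *: t) 0 (a / b) (1 - a / b).
rewrite scaler0 addr0 scalerA divfK ?gt_eqF//; apply => //.
- by rewrite divr_ge0 // ltW.
- by rewrite subr_ge0 ler_pdivrMr // mul1r.
- lra.
Qed.

(** Stability under addition comes from the midpoint of two segments, shortened
to a common scale [m] which also absorbs the coefficient [a]. *)
Lemma line_space_submod K : convex_set K -> K 0 ->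
  submod_closed [in line_space K].
Proof.
move=> cK K0; split=> [|a u v]; rewrite !inE.
  by exists 1 => //; rewrite scaler0 oppr0.
move=> [e e0 [Ku KNu]] [d d0 [Kv KNv]].
have q0 : 0 < 1 + `|a| by rewrite ltr_pwDl.
pose m := Num.min (e / (1 + `|a|)) d.
have m0 : 0 < m by rewrite lt_min d0 divr_gt0.
have md : m <= d by rewrite ge_min lexx orbT.
have mae : m * `|a| <= e.
  apply: (@le_trans _ _ (m * (1 + `|a|))).
    by rewrite ler_pM2l // lerDr.
  by rewrite -ler_pdivlMr // ge_min lexx.
have Kmv : K (m *: v) by apply: star_shaped (Kv) => //; exact: ltW.
have KmNv : K (m *: - v).
  by apply: star_shaped (_ : K (d *: - v)) => //; rewrite ?scalerN// ltW.
have ma0 : 0 <= m * `|a| by rewrite mulr_ge0 // ltW.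
have Kmau : K ((m * `|a|) *: u) by apply: star_shaped (Ku).
have KmaNu : K ((m * `|a|) *: - u).
  by apply: star_shaped (_ : K (e *: - u)) => //; rewrite scalerN.
have [Kau KaNu] : K (m *: (a *: u)) /\ K (m *: - (a *: u)).
  rewrite !scalerN scalerA; have [a0|a0] := ger0P a.
    by move: Kmau KmaNu; rewrite ger0_norm // scalerN.
  move: Kmau KmaNu; rewrite ltr0_norm // scalerN mulrN !scaleNr opprK.
  by split.
move: cK => /convex_setP cK.
have h0 : (0 : R) <= 2^-1 by lra.
have h1 : (2^-1 : R) + 2^-1 = 1 by lra.
exists (m / 2); first lra.
split.
  have -> : (m / 2) *: (a *: u + v) =
            2^-1 *: (m *: (a *: u)) + 2^-1 *: (m *: v).
    by apply/rowP => i; rewrite !mxE; lra.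
  exact: cK.
have -> : - ((m / 2) *: (a *: u + v)) =
          2^-1 *: (m *: - (a *: u)) + 2^-1 *: (m *: - v).
  by apply/rowP => i; rewrite !mxE; lra.
exact: cK.
Qed.

(** If [w] lies strictly between [y] and [z], and [K] contains a negative
multiple of [w], then some convex combination of that multiple with [z] cancels
the component along [z] and leaves a negative multiple of [y]. *)
Lemma face_line_space K : convex_set K -> K 0 ->
  is_face K (K `&` line_space K).
Proof.
move=> cK K0; split; first by move=> t [].
have cK' := (convex_setP _).1 cK.
suff opp y z s (e : R) : K y -> K z -> 0 < s -> s < 1 -> 0 < e ->
    K (- (e *: ((1 - s) *: y + s *: z))) -> line_space K y.
  move=> y z Ky Kz [w [[[s s01 sw] wyz] [_ [e e0 [_ KNw]]]]].
  move: s01; rewrite /= in_itv /= => /andP[s0 s1].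
  have {}s0 : 0 < s.
    rewrite lt_neqAle s0 andbT; apply: contra_notN wyz => /eqP se.
    by left; rewrite -sw -se subr0 scale1r scale0r addr0.
  have {}s1 : s < 1.
    rewrite lt_neqAle s1 andbT; apply: contra_notN wyz => /eqP se.
    by right; rewrite -sw se subrr scale1r scale0r add0r.
  rewrite -sw in KNw.
  split; split => //; first exact: opp KNw.
  apply: (opp z y (1 - s) e) => //; [lra|lra|].
  by rewrite subKr [X in - (e *: X)]addrC.
move=> Ky Kz s0 s1 e0 KNw.
have es0 : 0 < 1 + e * s by rewrite addr_gt0 // mulr_gt0.
(* The multiple of [y] left once the component along [z] has been cancelled. *)
pose d := e * (1 - s) / (1 + e * s).
have d0 : 0 < d by rewrite divr_gt0 // mulr_gt0 // subr_gt0.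
have KNdy : K (- (d *: y)).
  have -> : - (d *: y) = (1 + e * s)^-1 *: - (e *: ((1 - s) *: y + s *: z)) +
                         (e * s / (1 + e * s)) *: z.
    by apply/rowP => i; rewrite !mxE /d; field; rewrite gt_eqF.
  apply: cK' => //.
  - by rewrite invr_ge0 ltW.
  - by rewrite ltW // divr_gt0 // mulr_gt0.
  - by field; rewrite gt_eqF.
pose m := Num.min d 1.
have m0 : 0 < m by rewrite lt_min d0 ltr01.
exists m => //; split.
  apply: (@star_shaped _ _ _ 1) => //; [exact: ltW|by rewrite ge_min lexx orbT|].
  by rewrite scale1r.
rewrite -scalerN; apply: (@star_shaped _ _ _ d) => //.
- exact: ltW.
- by rewrite ge_min lexx.
- by rewrite scalerN.
Qed.

(** The faces through [0] all contain the segments of [K] around [0], and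
[K `&` line_space K] is a face made of those segments only. *)
Lemma lin_span_face0 K : convex_set K -> K 0 ->
  lin_span (face_hull K [set 0]) = line_space K.
Proof.
move=> cK K0; apply/seteqP; split=> t.
  apply; split; first exact: line_space_submod.
  move=> u; case/(_ (K `&` line_space K)) => //; split.
    exact: face_line_space.
  move=> _ ->; split => //.
  by have [] := line_space_submod cK K0; rewrite inE.
move=> [e e0 [Kt KNt]] V [[_ VL] FV].
have V0 : V 0 by apply: FV => F [_]; exact.
have [->//|t0] := eqVneq t 0.
suff Vet : V (e *: t).
  have := VL e^-1 (e *: t) 0; rewrite !inE scalerA mulVf ?gt_eqF//.
  by rewrite scale1r addr0; exact.
apply: FV => F [[_ faceF] F0].
suff : F (e *: t) /\ F (- (e *: t)) by case.
have et0 : e *: t != 0 by rewrite scaler_eq0 gt_eqF.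
apply: faceF => //; exists 0; split; last exact: F0.
split.
  exists 2^-1; first by rewrite /= in_itv /=; lra.
  by apply/rowP => i; rewrite !mxE; lra.
move=> [/esym/eqP|/esym/eqP]; first exact/negP.
by rewrite oppr_eq0; exact/negP.
Qed.

Lemma convex_minkowski_diff C D : convex_set C -> convex_set D ->
  convex_set (minkowski_diff C D).
Proof.
move=> /convex_setP cC /convex_setP cD; apply/convex_setP.
move=> _ _ s t s0 t0 st [c Cc [d Dd <-]] [c' Cc' [d' Dd' <-]].
exists (s *: c + t *: c'); first exact: cC.
exists (s *: d + t *: d'); first exact: cD.
by rewrite !scalerBr addrACA -opprD.
Qed.

Variables (C D : set 'rV[R]_n).
Hypotheses (cC : convex_set C) (cD : convex_set D).

Let CD := minkowski_diff C D.
Let cCD : convex_set CD.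
Proof. exact: convex_minkowski_diff. Qed.

Lemma joint_suppE : C `&` D !=set0 -> joint_supp C D = line_space CD.
Proof.
move=> [x [Cx Dx]]; apply: lin_span_face0 => //.
by exists x => //; exists x => //; rewrite subrr.
Qed.

Let TL (a : R) u v :
  joint_supp C D u -> joint_supp C D v -> joint_supp C D (a *: u + v).
Proof.
by have [_ /(_ a u v)] := lin_span_submod (face_hull CD [set 0]); rewrite !inE.
Qed.

Let T0 : joint_supp C D 0.
Proof. by have [] := lin_span_submod (face_hull CD [set 0]); rewrite inE. Qed.

Lemma joint_suppB u v :
  joint_supp C D u -> joint_supp C D v -> joint_supp C D (u - v).
Proof. by move=> Tu Tv; rewrite addrC -scaleN1r; exact: TL. Qed.

Lemma joint_suppD u v :
  joint_supp C D u -> joint_supp C D v -> joint_supp C D (u + v).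
Proof. by move=> Tu; rewrite -[u]scale1r; exact: TL. Qed.

Lemma joint_suppZ a u : joint_supp C D u -> joint_supp C D (a *: u).
Proof. by move=> Tu; rewrite -[_ *: _]addr0; exact: TL. Qed.

Lemma joint_supp_subI x y : (C `&` D) x -> (C `&` D) y ->
  joint_supp C D (x - y).
Proof.
move=> [Cx Dx] [Cy Dy]; rewrite joint_suppE; last by exists x.
exists 1 => //; rewrite scale1r opprB.
by split; [exists x => //; exists y|exists y => //; exists x].
Qed.

(** [aff_joint_supp C D] is a single translate of [joint_supp C D], since
two points of [C `&` D] differ by an element of the latter. *)
Lemma aff_joint_suppE p y : (C `&` D) p ->
  aff_joint_supp C D y <-> joint_supp C D (y - p).
Proof.
move=> CDp; split=> [[t Tt [q CDq <-]]|Ty]; last first.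
  by exists (y - p) => //; exists p => //; rewrite subrK.
by rewrite -addrA; apply: joint_suppD => //; exact: joint_supp_subI.
Qed.

Lemma aff_joint_supp_nonempty y : aff_joint_supp C D y -> C `&` D !=set0.
Proof. by move=> [_ _ [p CDp _]]; exists p. Qed.

Lemma subI_aff_joint_supp : C `&` D `<=` aff_joint_supp C D.
Proof. by move=> p CDp; apply/(aff_joint_suppE _ CDp); rewrite subrr. Qed.

Lemma convex_aff_joint_supp : convex_set (aff_joint_supp C D).
Proof.
apply/convex_setP => y z s t s0 t0 st Ty Tz.
have [p CDp] := aff_joint_supp_nonempty Ty.
move: Ty Tz; rewrite !(aff_joint_suppE _ CDp) => Ty Tz.
have -> : s *: y + t *: z - p = s *: (y - p) + t *: (z - p).
  rewrite !scalerBr addrACA -opprD -scalerDl st scale1r //.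
by apply: joint_suppD; exact: joint_suppZ.
Qed.

Lemma aff_joint_suppB y z : aff_joint_supp C D y -> aff_joint_supp C D z ->
  joint_supp C D (y - z).
Proof.
move=> Ty; have [p CDp] := aff_joint_supp_nonempty Ty.
move: Ty; rewrite !(aff_joint_suppE _ CDp) => Ty Tz.
have -> : y - z = (y - p) - (z - p) by rewrite opprB addrA subrK.
exact: joint_suppB.
Qed.

(** This is the constraint qualification: the two ends [c - d] and [c' - d'] of
a segment around [0] in [C - D] give a common point [p], the half-sum of [c] and
[c'] as well as of [d] and [d'], through which [c] and [d] are seen to belong to
[aff_joint_supp C D]. *)
Lemma joint_supp_restricted_diff t : C `&` D !=set0 -> joint_supp C D t ->
  exists2 e : R, 0 < e & exists c d,
    [/\ C c, D d, aff_joint_supp C D c, aff_joint_supp C D d &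
        e *: t = c - d].
Proof.
move=> CD0; rewrite joint_suppE // => -[e e0 []].
move=> [c Cc [d Dd cde]] [c' Cc' [d' Dd' cde']].
exists e => //; exists c, d.
pose p := 2^-1 *: c + 2^-1 *: c'.
have pE : p = 2^-1 *: d + 2^-1 *: d'.
  apply/rowP => i; have := congr1 (fun h : 'rV_n => h ord0 i) cde.
  have := congr1 (fun h : 'rV_n => h ord0 i) cde'.
  by rewrite !mxE; lra.
have h0 : (0 : R) <= 2^-1 by lra.
have h1 : (2^-1 : R) + 2^-1 = 1 by lra.
have CDp : (C `&` D) p.
  split; first exact: (convex_setP _).1.
  by rewrite pE; exact: (convex_setP _).1.
have [Cp Dp] := CDp.
split => //; apply/(aff_joint_suppE _ CDp); rewrite joint_suppE //.
- exists 1 => //; rewrite scale1r; split; first by exists c => //; exists p.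
  exists c' => //; exists p => //.
  by apply/rowP => i; rewrite !mxE; lra.
- exists 1 => //; rewrite scale1r opprB; split; last by exists p => //; exists d.
  exists p => //; exists d' => //.
  by rewrite pE; apply/rowP => i; rewrite !mxE; lra.
Qed.

End line_space.

(** * The sum rule under a constraint qualification *)

Section sum_rule.
Context {R : realType} {n : nat}.
Implicit Types (f g : 'rV[R]_n -> \bar R) (x y v w t : 'rV[R]_n).

Lemma convex_efunP f : convex_efun f <->
  forall x y (a b s t : R), 0 <= s -> 0 <= t -> s + t = 1 ->
    (f x <= a%:E)%E -> (f y <= b%:E)%E ->
    (f (s *: x + t *: y)%R <= (s * a + t * b)%:E)%E.
Proof.
rewrite /convex_efun convex_setP; split=> cf.
  move=> x y a b s t s0 t0 st fx fy.
  exact: (cf (x, a) (y, b) s t s0 t0 st fx fy).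
move=> [x a] [y b] s t s0 t0 st fx fy; exact: cf.
Qed.

Lemma edom_fine f y : (forall y, f y != -oo%E) -> edom f y ->
  f y = (fine (f y))%:E.
Proof. by move=> fN fy; rewrite fineK // fin_numE fN fy. Qed.

Lemma le_edom f y (a : R) : (f y <= a%:E)%E -> edom f y.
Proof. by rewrite /edom /=; case: (f y). Qed.

Lemma convex_edom f : (forall y, f y != -oo%E) -> convex_efun f ->
  convex_set (edom f).
Proof.
move=> fN /convex_efunP cf; apply/convex_setP => x y s t s0 t0 st fx fy.
apply: (@le_edom _ _ (s * fine (f x) + t * fine (f y))).
by apply: cf; rewrite -?edom_fine.
Qed.

Lemma edomD f g y : (forall y, f y != -oo%E) -> (forall y, g y != -oo%E) ->
  edom (fun y => f y + g y)%E y <-> edom f y /\ edom g y.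
Proof.
move=> /(_ y) + /(_ y); rewrite /edom /=.
by case: (f y) => [?||]; case: (g y) => [?||] // _ _; split => // -[].
Qed.

Lemma subdiff_fine f x v : (forall y, f y != -oo%E) -> edom f x ->
  subdiff f x v <->
  forall y, edom f y -> fine (f x) + dotv v (y - x) <= fine (f y).
Proof.
move=> fN fx; split=> [[_ fv] y fy|fv].
  by have := fv y; rewrite (edom_fine fN fx) (edom_fine fN fy) -EFinD lee_fin.
split => // y; have [->|/eqP fy] := eqVneq (f y) +oo%E; first exact: leey.
rewrite (edom_fine fN fx) (edom_fine fN (introN eqP fy)).
by rewrite -EFinD lee_fin; apply: fv; exact/eqP.
Qed.

Lemma subdiffD_sub f g x :
  (forall y, f y != -oo%E) -> (forall y, g y != -oo%E) ->
  minkowski_sum (subdiff f x) (subdiff g x) `<=`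
  subdiff (fun y => f y + g y)%E x.
Proof.
move=> fN gN _ [u [fx fu] [v [gx gv] <-]]; split; first exact/edomD.
move=> y; rewrite dotvDl EFinD addeACA; exact: leeD.
Qed.

(** The last hypothesis says that the cone generated by [edom f - edom g] is
symmetric, i.e. that [0] is in the relative interior of this convex set when
it is nonempty. *)
Lemma subdiffD f g x :
  (forall y, f y != -oo%E) -> (forall y, g y != -oo%E) ->
  convex_efun f -> convex_efun g ->
  (forall c d, edom f c -> edom g d -> exists2 e : R, 0 < e &
     exists c' d', [/\ edom f c', edom g d' & e *: (d - c) = c' - d']) ->
  subdiff (fun y => f y + g y)%E x =
  minkowski_sum (subdiff f x) (subdiff g x).
Proof.
move=> fN gN /convex_efunP cf /convex_efunP cg qual.
apply/seteqP; split; last exact: subdiffD_sub.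
move=> v [/edomD[]// fx gx fgv].
pose m := fine (f x) + fine (g x) - dotv v x.
(* The inequality defining [v], with all the terms in [x] moved into [m]. *)
have mP y (a b : R) : (f y <= a%:E)%E -> (g y <= b%:E)%E ->
    m <= a + b - dotv v y.
  move=> fa gb; have := le_trans (fgv y) (leeD fa gb).
  rewrite (edom_fine fN fx) (edom_fine gN gx) -!EFinD lee_fin.
  by rewrite dotvDr dotvNr /m; lra.
(* The cone generated by the epigraph of the shifted perturbation function, [mu]
   being the inverse of a step length along [t]. *)
pose P t (r : R) := exists (mu : R) c d (a b : R),
  [/\ 0 < mu, (f c <= a%:E)%E, (g d <= b%:E)%E, t = mu *: (c - d) &
      mu * (a + b - dotv v d - m) <= r].
have Pdiff c d : edom f c -> edom g d ->
    P (c - d) (fine (f c) + fine (g d) - dotv v d - m).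
  move=> fc gd; exists 1, c, d, (fine (f c)), (fine (g d)).
  by rewrite -!edom_fine // scale1r mul1r.
have Pscale (k : R) t r : 0 < k -> P t r -> P (k *: t) (k * r).
  move=> k0 [mu [c [d [a [b [mu0 fc gd -> mr]]]]]].
  exists (k * mu), c, d, a, b; split => //; first exact: mulr_gt0.
    by rewrite scalerA.
  by rewrite -mulrA ler_pM2l.
have [|||w wP] := @dominated_functional _ _ P _ Pscale.
- move=> t1 t2 r1 r2 [m1 [c1 [d1 [a1 [b1 [m10 fc1 gd1 -> mr1]]]]]].
  move=> [m2 [c2 [d2 [a2 [b2 [m20 fc2 gd2 -> mr2]]]]]].
  have m0 : 0 < m1 + m2 by exact: addr_gt0.
  have mN0 : m1 + m2 != 0 by rewrite gt_eqF.
  pose s := m1 / (m1 + m2); pose t := m2 / (m1 + m2).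
  have s0 : 0 <= s by rewrite divr_ge0 // ltW.
  have t0 : 0 <= t by rewrite divr_ge0 // ltW.
  have st : s + t = 1 by rewrite /s /t -mulrDl divff.
  exists (m1 + m2), (s *: c1 + t *: c2), (s *: d1 + t *: d2).
  exists (s * a1 + t * a2), (s * b1 + t * b2).
  split => //; [exact: cf|exact: cg| |].
    by apply/rowP => i; rewrite !mxE /s /t; field.
  apply: le_trans (lerD mr1 mr2); rewrite dotvDr !dotvZr.
  by rewrite le_eqVlt; apply/orP; left; apply/eqP; rewrite /s /t; field.
- move=> r [mu [c [d [a [b [mu0 fc gd /esym/eqP]]]]]].
  rewrite scaler_eq0 gt_eqF //= subr_eq0 => /eqP cd; apply: le_trans.
  rewrite mulr_ge0 //; first exact: ltW.
  by rewrite subr_ge0; apply: mP => //; rewrite -cd.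
- move=> _ r [mu [c [d [a [b [mu0 fc gd -> _]]]]]].
  have [e e0 [c' [d' [fc' gd' cd']]]] := qual _ _ (le_edom fc) (le_edom gd).
  have -> : - (mu *: (c - d)) = (mu / e) *: (c' - d').
    by rewrite -cd' scalerA divfK ?gt_eqF // -scalerN opprB.
  by eexists; apply: Pscale; [exact: divr_gt0|exact: Pdiff].
exists w; [|exists (v - w); last by rewrite addrC subrK].
  apply/subdiff_fine => // y fy; have := wP _ _ (Pdiff _ _ fy gx).
  by rewrite /m; lra.
apply/subdiff_fine => // y gy; have := wP _ _ (Pdiff _ _ fx gy).
by rewrite /m dotvDl dotvNl !dotvDr !dotvNr; lra.
Qed.

End sum_rule.

(** * Restriction to a convex set *)

Section restriction.
Context {R : realType} {n : nat}.
Implicit Types (f : 'rV[R]_n -> \bar R) (S : set 'rV[R]_n).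

Lemma add_iota_set f S y : (forall y, f y != -oo%E) ->
  (f y + iota_set S y = if y \in S then f y else +oo)%E.
Proof.
by move=> fN; rewrite /iota_set; case: ifP => _; rewrite ?adde0 ?addey.
Qed.

Lemma edom_iota f S y : (forall y, f y != -oo%E) ->
  edom (fun y => f y + iota_set S y)%E y <-> edom f y /\ S y.
Proof.
move=> fN; rewrite /edom /= add_iota_set //.
case: ifPn => [/set_mem Sy|/negP yS]; split => //; first by case.
by case=> _ /mem_set.
Qed.

Lemma convex_efun_iota f S : (forall y, f y != -oo%E) ->
  convex_efun f -> convex_set S ->
  convex_efun (fun y => f y + iota_set S y)%E.
Proof.
move=> fN /convex_efunP cf /convex_setP cS.
apply/convex_efunP => x y a b s t s0 t0 st; rewrite !add_iota_set //.
case: ifP => [/set_mem Sx fx|//]; case: ifP => [/set_mem Sy fy|//].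
by rewrite mem_set; [exact: cf|exact: cS].
Qed.

Lemma iota_neqNy f S : (forall y, f y != -oo%E) ->
  forall y, (f y + iota_set S y)%E != -oo%E.
Proof. by move=> fN y; rewrite add_iota_set //; case: ifP. Qed.

End restriction.

Theorem corollary5p1 (R : realType) (n : nat) (f g : 'rV[R]_n -> \bar R)
    (x : 'rV[R]_n) :
  convex_efun f -> proper_efun f -> convex_efun g -> proper_efun g ->
  let Ta := aff_joint_supp (edom f) (edom g) in
  subdiff (fun y => f y + g y)%E x =
    minkowski_sum (subdiff (fun y => f y + iota_set Ta y)%E x)
                  (subdiff (fun y => g y + iota_set Ta y)%E x).
Proof.
move=> cf [fN _] cg [gN _] Ta.
have cC := convex_edom fN cf; have cD := convex_edom gN cg.
have cTa : convex_set Ta by exact: convex_aff_joint_supp.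
rewrite -subdiffD; [|exact: iota_neqNy|exact: iota_neqNy|
    exact: convex_efun_iota|exact: convex_efun_iota|].
  congr (subdiff _ x); apply/funext => y; rewrite !add_iota_set //.
  case: ifPn => // /negP yTa.
  have : ~ (edom (fun y => f y + g y)%E y).
    by move=> /edomD[]// fy gy; apply/yTa/mem_set/subI_aff_joint_supp.
  by move=> /negP; rewrite negbK => /eqP.
move=> c d /edom_iota[]// fc Tc /edom_iota[]// gd Td.
have [e e0 [c' [d' [fc' gd' Tc' Td' cd]]]] := joint_supp_restricted_diff cC cD
  (aff_joint_supp_nonempty Tc) (aff_joint_suppB cC cD Td Tc).
by exists e => //; exists c', d'; split => //; apply/edom_iota.
Qed.
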